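(* Let $\tilde G$ be a finite or infinite weighted graph, of bounded valence and bounded degree if infinite, and let $G$ be a finite or infinite subgraph of $\tilde G$. Let $H_{\tilde G}$ be the heat kernel on $\tilde G$ and define $H(v_1,v_2;t):=H_{\tilde G}(v_1,v_2;t)$ for $v_1,v_2\in VG$ and $t\geq0$. Then: (i) For all $v_1,v_2\in VG$, $\lim_{t\to0}H(v_1,v_2;t)$ equals $1$ if $v_1=v_2$ and $0$ if $v_1\neq v_2$. (ii) For $v_1,v_2\in VG$, there is a constant $C(v_1,v_2)$ such that for all $t>0$ $$\left|\frac{\partial}{\partial t}H(v_1,v_2;t)\right|\leq C(v_1,v_2).$$
   Context: $\tilde G$ is a weighted graph with vertex set $V\tilde G$ and symmetric weight function $\tilde w_{xy}=\tilde w_{yx}\in[0,\infty)$. When $\tilde G$ is infinite, it is assumed to have bounded valence: for every $x$ the function $\tilde w(x,\cdot)$ has finite support, and $\tilde\mu(x)=\sum_{y\in V\tilde G}\tilde w_{xy}$ is uniformly bounded in $x$; and bounded degree: the number of $y$ with $\tilde w_{xy}>0$ is uniformly bounded in $x$. A subgraph $G$ is given by a subset $VG\subseteq V\tilde G$ and a (symmetric) weight function $w$ on $VG\times VG$ with each $w_{xy}$ equal either to $\tilde w_{xy}$ or to $0$. The Laplacian $\Delta_{\tilde G}f(x)=\sum_{y\in V\tilde G}(f(x)-f(y))\tilde w_{xy}$ is a non-negative self-adjoint operator on $L^2(V\tilde G)$ (counting measure). The heat kernel $H_{\tilde G}$ is the fundamental solution of the heat equation $(\Delta_{\tilde G,v_1}+\partial_t)H_{\tilde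 G}(v_1,v_2;t)=0$ with $\lim_{t\to0}H_{\tilde G}(v_1,v_2;t)=\delta_{v_1=v_2}$, where $\Delta_{\tilde G,v_1}$ acts in the first variable; it exists and is unique (as bounded solution), and is the kernel of the semigroup $e^{-t\Delta_{\tilde G}}$ on $L^2(V\tilde G)$. *)

(* Defs.v *)
From HB Require Import structures.
From mathcomp Require Import all_boot all_order all_algebra.
From mathcomp Require Import all_classical all_reals all_analysis.

Set Implicit Arguments.
Unset Strict Implicit.
Unset Printing Implicit Defensive.

Import Order.TTheory GRing.Theory Num.Theory.
Import numFieldNormedType.Exports.

Local Open Scope classical_set_scope.
Local Open Scope ring_scope.

(* Loops are allowed; they do not affect the Laplacian. *)
Record weighted_graph (R : realType) := WeightedGraph {
  vertex : choiceType;
  weight : vertex -> vertex -> R;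
  weight_ge0 : forall x y, 0 <= weight x y;
  weight_sym : forall x y, weight x y = weight y x
}.

(* The set [subvertex] coerces to the subtype of its elements. *)
Record subgraph (R : realType) (G : weighted_graph R) := Subgraph {
  subvertex : set (vertex G);
  subweight : subvertex -> subvertex -> R;
  subweight_sym : forall x y, subweight x y = subweight y x;
  subweightP : forall x y : subvertex,
    subweight x y = weight (val x) (val y) \/ subweight x y = 0
}.

Section Defs.
Context (R : realType) (G : weighted_graph R).
Local Notation V := (vertex G).

(* [\sum_(y \in A)] is the sum over the support of the summand, and is 0 by
   convention when that support is infinite; the finiteness clause of
   [bounded_valence] rules this case out here and in [laplacian]. *)
Definition valence (x : V) : R := \sum_(y \in [set: V]) weight x y.

Definition bounded_valence : Prop :=
  (forall x : V, finite_set [set y | weight x y != 0]) /\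
  (exists M : R, forall x : V, valence x <= M).

Definition bounded_degree : Prop :=
  exists D : nat, forall x : V, ([set y | 0 < weight x y] #<= `I_D)%card.

Definition laplacian (f : V -> R) (x : V) : R :=
  \sum_(y \in [set: V]) (f x - f y) * weight x y.

(* Only times [t >= 0] are constrained.  The value at [t = 0] is the one given
   by continuity. *)
Definition fundamental_solution (H : V -> V -> R -> R) : Prop :=
  [/\ forall v1 v2 t, 0 < t -> derivable (H v1 v2) t 1,
      forall v1 v2 t, 0 < t ->
        laplacian (fun v => H v v2 t) v1 + derive1 (H v1 v2) t = 0,
      forall v1 v2, H v1 v2 t @[t --> 0^'+] --> ((v1 == v2)%:R : R)
    & forall v1 v2, H v1 v2 0 = (v1 == v2)%:R].

Definition bounded_solution (H : V -> V -> R -> R) : Prop :=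
  forall v2, exists C : R, forall v1 t, 0 < t -> `|H v1 v2 t| <= C.

(* The bounded fundamental solution, by description: [get] selects an element
   of a set, with a default value when the set is empty.  For graphs that are
   finite or of bounded valence the solution exists and is unique on
   [t >= 0]. *)
Definition heat_kernel : V -> V -> R -> R :=
  get [set H | fundamental_solution H /\ bounded_solution H].

Definition restricted_heat_kernel (VG : set V) (v1 v2 : VG) (t : R) : R :=
  heat_kernel (val v1) (val v2) t.

End Defs.

(* Main.v *)
(* If [M] bounds the valence, then [A = M - laplacian] has nonnegative entries and
   row sums [M], so [|A^n delta_v| <= M^n].  Hence the kernel
   [exp (- M t) * \sum_n t^n / n! * A^n delta_{v2} (v1)] of [exp (- t laplacian)]
   is a fundamental solution bounded by 1, and [heat_kernel] is a bounded
   fundamental solution.  The heat equation then bounds its time derivative at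
   [v1] by twice the valence of [v1] times the bound on the kernel. *)
Require Import Defs.
From HB Require Import structures.
From mathcomp Require Import all_boot all_order all_algebra.
From mathcomp Require Import all_classical all_reals all_analysis.
From mathcomp Require Import ring finmap.
Import Order.TTheory GRing.Theory Num.Theory.
Import numFieldNormedType.Exports.
Local Open Scope classical_set_scope.
Local Open Scope ring_scope.

(** * Exponential generating functions of sequences of geometric growth *)

Section ExponentialGeneratingFunction.
Context {R : realType}.
Implicit Types (a b : R^nat) (C M t c : R).

(** The rate [M] is a parameter and only the constant is existential, so that for a fixed [M]
    shifts, scalings and finite sums stay in the class. *)
Definition exp_bounded M a := exists C, forall n, `|a n| <= C * M ^+ n.

(** For [a n = (A^n f)(x)] this is [(exp (t A) f)(x)], and shifting [a] amounts to applying [A] once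
    more. *)
Definition egf a t : R := limn (pseries (fun n => a n / n`!%:R) t).

Lemma exp_bounded_shift M a : exp_bounded M a -> exp_bounded M (fun n => a n.+1).
Proof.
by move=> [C aC]; exists (C * M) => n; rewrite -mulrA -exprS.
Qed.

(** Comparison with the series of [C * expR (M * |t|)], which yields both absolute convergence and
    the bound [egf_le]. *)
Lemma egf_term_le M C a t n : (forall m, `|a m| <= C * M ^+ m) ->
  `|a n / n`!%:R * t ^+ n| <= C * exp_coeff (M * `|t|) n.
Proof.
move=> aC; rewrite !normrM normfV normrX normr_nat.
rewrite [leRHS](_ : _ = C * M ^+ n / n`!%:R * `|t| ^+ n).
  by rewrite ler_wpM2r ?exprn_ge0// ler_wpM2r ?invr_ge0.
by rewrite /exp_coeff /= exprMn; ring.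
Qed.

Lemma normed_egf_is_cvg M C a t : 0 <= M -> (forall n, `|a n| <= C * M ^+ n) ->
  cvgn [normed pseries (fun n => a n / n`!%:R) t].
Proof.
move=> M0 aC.
apply: (@series_le_cvg _ _ (fun n => C * exp_coeff (M * `|t|) n)) => [n|n|n|].
- exact: normr_ge0.
- exact: le_trans (normr_ge0 _) (egf_term_le M C a t n aC).
- exact: egf_term_le.
- exact: is_cvg_seriesZ (is_cvg_series_exp_coeff _).
Qed.

Lemma is_cvg_egf M a t : 0 <= M -> exp_bounded M a ->
  cvgn (pseries (fun n => a n / n`!%:R) t).
Proof. by move=> M0 [C aC]; exact/normed_cvg/(normed_egf_is_cvg M C). Qed.

Lemma egf_le M C a t : 0 <= M -> (forall n, `|a n| <= C * M ^+ n) ->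
  `|egf a t| <= C * expR (M * `|t|).
Proof.
move=> M0 aC; have cvgn_a := normed_egf_is_cvg M C a t M0 aC.
apply: le_trans (lim_series_norm _) _ => //.
rewrite /expR -[C * _]/(C *: (_ : R^o)) -lim_seriesZ; last exact: is_cvg_series_exp_coeff.
apply: lim_series_le => //; first exact: is_cvg_seriesZ (is_cvg_series_exp_coeff _).
by move=> n; exact: egf_term_le.
Qed.

Lemma egf0 a : egf a 0 = a 0%N.
Proof.
(* The partial sum of length 0 is 0; only from length 1 on are the partial sums constantly [a 0],
   hence the shift. *)
apply: cvg_lim => //; rewrite -(cvg_shiftn 1) /=.
rewrite (_ : (fun _ => _) = fun=> a 0%N); first exact: cvg_cst.
apply/funext => n; rewrite /pseries /series /= addn1 big_nat_recl//= big1.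
  by rewrite fact0 expr0 divr1 mulr1 addr0.
by move=> i _; rewrite expr0n mulr0.
Qed.

(** In the termwise derivative the factor [n + 1] cancels against [(n + 1)!], which leaves the
    shifted sequence. *)
Lemma is_derive_egf M a t : 0 <= M -> exp_bounded M a ->
  is_derive t (1 : R) (egf a) (egf (fun n => a n.+1) t).
Proof.
move=> M0 aM.
have aM1 := exp_bounded_shift M _ aM; have aM2 := exp_bounded_shift M _ aM1.
have diffsE b : pseries_diffs (fun n => b n / n`!%:R) = (fun n => b n.+1 / n`!%:R).
  apply/funext => n; rewrite /pseries_diffs factS natrM invfM.
  by rewrite mulrCA mulVKf.
(* Termwise differentiation at [t] asks that the series and its first two formal derivatives
   converge at a point of larger modulus; [|t| + 1] serves. *)
rewrite /egf -(diffsE a); apply: (@pseries_snd_diffs _ _ (`|t| + 1)); rewrite ?diffsE.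
- exact: is_cvg_egf aM.
- exact: is_cvg_egf aM1.
- exact: is_cvg_egf aM2.
- by rewrite [ltRHS]ger0_norm ?addr_ge0// ltrDl.
Qed.

Lemma egfZ M c a t : 0 <= M -> exp_bounded M a ->
  egf (fun n => c * a n) t = c * egf a t.
Proof.
move=> M0 aM; rewrite /egf /pseries -[c * _]/(c *: (_ : R^o)) -lim_seriesZ; last exact: is_cvg_egf aM.
by congr (limn (series _)); apply/funext => n; rewrite /= -!(mulrA c).
Qed.

Lemma egfD M a b t : 0 <= M -> exp_bounded M a -> exp_bounded M b ->
  egf (fun n => a n + b n) t = egf a t + egf b t.
Proof.
move=> M0 aM bM; rewrite /egf /pseries -lim_seriesD; last 2 first.
- exact: is_cvg_egf aM.
- exact: is_cvg_egf bM.
by congr (limn (series _)); apply/funext => n; rewrite /= !mulrDl.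
Qed.

Lemma exp_boundedZ M c a : exp_bounded M a -> exp_bounded M (fun n => c * a n).
Proof.
move=> [C aC]; exists (`|c| * C) => n.
by rewrite normrM -mulrA ler_wpM2l.
Qed.

Lemma exp_boundedD M a b : exp_bounded M a -> exp_bounded M b ->
  exp_bounded M (fun n => a n + b n).
Proof.
move=> [C aC] [D bD]; exists (C + D) => n.
by rewrite mulrDl (le_trans (ler_normD _ _))// lerD.
Qed.

Lemma exp_bounded_sum M (I : Type) (r : seq I) (f : I -> R^nat) :
  (forall i, exp_bounded M (f i)) -> exp_bounded M (fun n => \sum_(i <- r) f i n).
Proof.
move=> fM; elim: r => [|i r IHr].
  by exists 0 => n; rewrite big_nil normr0 mul0r.
rewrite (_ : (fun _ => _) = fun n => f i n + \sum_(j <- r) f j n).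
  exact: exp_boundedD.
by apply/funext => n; rewrite big_cons.
Qed.

Lemma egf_sum M (I : Type) (r : seq I) (f : I -> R^nat) t : 0 <= M ->
  (forall i, exp_bounded M (f i)) ->
  egf (fun n => \sum_(i <- r) f i n) t = \sum_(i <- r) egf (f i) t.
Proof.
move=> M0 fM; elim: r => [|i r IHr].
  (* The empty sum is written as 0 times a sequence so that [egfZ] evaluates it. *)
  rewrite big_nil (_ : (fun _ => _) = fun n => 0 * \sum_(j <- [::]) f j n).
    by rewrite (egfZ M) ?mul0r//; exact: exp_bounded_sum.
  by apply/funext => n; rewrite big_nil mul0r.
rewrite big_cons -IHr -(egfD M)//; last exact: exp_bounded_sum.
by congr egf; apply/funext => n; rewrite big_cons.
Qed.

End ExponentialGeneratingFunction.

(** * The Laplacian of a locally finite graph *)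

Section HeatKernel.
Context {R : realType} {G : weighted_graph R}.
Local Notation V := (vertex G).
Hypothesis locally_finite : forall x : V, finite_set [set y | weight x y != 0].
Implicit Types (f : V -> R) (x : V).

Definition neighbors x : {fset V} := fset_set [set y | weight x y != 0].

(** Local finiteness turns the sum over all vertices into one over a finite set depending on [x]
    only, whatever [h] is. *)
Lemma sum_neighbors (h : V -> R) x :
  \sum_(y \in [set: V]) h y * weight x y = \sum_(y <- neighbors x) h y * weight x y.
Proof.
apply: fsbigTE => y; rewrite in_fset_set// notin_setE /=.
by move=> /negP; rewrite negbK => /eqP ->; rewrite mulr0.
Qed.

Lemma valenceE x : valence x = \sum_(y <- neighbors x) weight x y.
Proof.
rewrite /valence; under eq_fsbigr do rewrite -[weight _ _]mul1r.
by rewrite sum_neighbors; under eq_bigr do rewrite mul1r.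
Qed.

Lemma norm_sum_neighbors_le (h : V -> R) x C : (forall y, `|h y| <= C) ->
  `|\sum_(y <- neighbors x) h y * weight x y| <= C * valence x.
Proof.
move=> hC; rewrite valenceE mulr_sumr; apply: le_trans (ler_norm_sum _ _ _) _.
apply: ler_sum => y _; rewrite normrM (ger0_norm (weight_ge0 _ _)).
by rewrite ler_wpM2r ?weight_ge0.
Qed.

Lemma norm_laplacian_le f x C : (forall y, `|f y| <= C) ->
  `|laplacian f x| <= (C + C) * valence x.
Proof.
move=> fC; rewrite /laplacian sum_neighbors; apply: norm_sum_neighbors_le => y.
by rewrite (le_trans (ler_normB _ _))// lerD.
Qed.

Lemma laplacianE f x : laplacian f x =
  valence x * f x - \sum_(y <- neighbors x) f y * weight x y.
Proof.
rewrite /laplacian sum_neighbors valenceE mulr_suml -sumrB.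
by apply: eq_bigr => y _; ring.
Qed.

Lemma laplacianZ c f x : laplacian (fun y => c * f y) x = c * laplacian f x.
Proof.
rewrite /laplacian !sum_neighbors mulr_sumr.
by apply: eq_bigr => y _; rewrite mulrA mulrBr.
Qed.

(** At a given vertex the Laplacian is a finite linear combination of values, so it passes through
    the power series by linearity. *)
Lemma laplacian_egf M (a : nat -> V -> R) x t : 0 <= M ->
  (forall y, exp_bounded M (a ^~ y)) ->
  laplacian (fun y => egf (a ^~ y) t) x = egf (fun n => laplacian (a n) x) t.
Proof.
move=> M0 aM; rewrite /laplacian sum_neighbors.
have aBM y : exp_bounded M (fun n => a n x + -1 * a n y).
  by apply: exp_boundedD => //; exact: exp_boundedZ.
rewrite [X in _ = egf X _](_ : _ = fun n =>
    \sum_(y <- neighbors x) weight x y * (a n x + -1 * a n y)); last first.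
  apply/funext => n; rewrite sum_neighbors.
  by apply: eq_bigr => y _; rewrite mulrC mulN1r.
rewrite (egf_sum M)//; last by move=> y; exact: exp_boundedZ.
apply: eq_bigr => y _; rewrite (egfZ M)// (egfD M)//; last exact: exp_boundedZ.
by rewrite (egfZ M)// mulN1r mulrC.
Qed.

(** * Uniformization, and the heat kernel *)

Context {M : R}.
Hypothesis M_ge0 : 0 <= M.
Hypothesis valence_le : forall x : V, valence x <= M.

Lemma norm_shifted_laplacian_le f x C : (forall y, `|f y| <= C) ->
  `|M * f x - laplacian f x| <= M * C.
Proof.
move=> fC; rewrite laplacianE.
(* By [valence_le] all coefficients are now nonnegative; they add up to [M]. *)
rewrite (_ : _ - _ = (M - valence x) * f x + \sum_(y <- neighbors x) f y * weight x y);
  last by ring.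
rewrite (le_trans (ler_normD _ _))//.
rewrite (_ : M * C = (M - valence x) * C + C * valence x); last by ring.
apply: lerD; last exact: norm_sum_neighbors_le.
by rewrite normrM ger0_norm ?subr_ge0// ler_wpM2l ?subr_ge0.
Qed.

(** The vectors [A^n delta_v] for [A = M - laplacian]. *)
Fixpoint shifted_iter (v : V) (n : nat) : V -> R :=
  if n is m.+1 then
    fun x => M * shifted_iter v m x - laplacian (shifted_iter v m) x
  else fun x => (x == v)%:R.

Lemma norm_shifted_iter_le v n x : `|shifted_iter v n x| <= 1 * M ^+ n.
Proof.
elim: n x => [|n IHn] x /=; first by rewrite normr_nat expr0 mulr1; case: eqP.
by rewrite mul1r exprS; apply: norm_shifted_laplacian_le => y; rewrite -[leRHS]mul1r.
Qed.

Lemma exp_bounded_shifted_iter v x : exp_bounded M ((shifted_iter v) ^~ x).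
Proof. by exists 1 => n; exact: norm_shifted_iter_le. Qed.

(** The kernel of [exp (- M t) exp (t A)]. The formula makes sense for every real [t], which gives
    two-sided differentiability at 0. *)
Definition uniformized_kernel (v1 v2 : V) (t : R) : R :=
  expR (- M * t) * egf ((shifted_iter v2) ^~ v1) t.

Lemma is_derive_uniformized_kernel v1 v2 t :
  is_derive t (1 : R) (uniformized_kernel v1 v2)
    (- laplacian (fun v => uniformized_kernel v v2 t) v1).
Proof.
have bnd := exp_bounded_shifted_iter v2.
have dS := is_derive_egf M _ t M_ge0 (bnd v1).
have dE : is_derive t (1 : R) (fun s => expR (- M * s)) (- M * expR (- M * t)).
  apply: is_derive_eq; rewrite /GRing.scale /=; ring.
rewrite /uniformized_kernel; apply: is_derive_eq.
(* The shifted sequence is [A] applied to the original one, and [laplacian = M - A]. *)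
have lapE : laplacian (fun v => egf ((shifted_iter v2) ^~ v) t) v1 =
    M * egf ((shifted_iter v2) ^~ v1) t - egf (fun n => shifted_iter v2 n.+1 v1) t.
  have bnd' := exp_bounded_shift _ _ (bnd v1).
  rewrite (laplacian_egf M)// -mulN1r -!(egfZ M)// -(egfD M)//; [|exact: exp_boundedZ..].
  by congr egf; apply/funext => n; rewrite /=; ring.
rewrite laplacianZ lapE /GRing.scale /=; ring.
Qed.

Lemma uniformized_kernel0 v1 v2 : uniformized_kernel v1 v2 0 = (v1 == v2)%:R.
Proof. by rewrite /uniformized_kernel egf0 mulr0 expR0 mul1r. Qed.

(** For [t >= 0] the growth [expR (M * t)] of the generating function is exactly offset by the
    factor [expR (- M * t)]. *)
Lemma norm_uniformized_kernel_le v1 v2 t : 0 <= t -> `|uniformized_kernel v1 v2 t| <= 1.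
Proof.
move=> t0; rewrite normrM (ger0_norm (expR_ge0 _)).
have := egf_le M 1 _ t M_ge0 (fun n => norm_shifted_iter_le v2 n v1).
rewrite mul1r (ger0_norm t0) -(ler_pM2l (expR_gt0 (- M * t))) => /le_trans; apply.
by rewrite -expRD mulNr addNr expR0.
Qed.

(** Since [get] returns an element of any nonempty set, it suffices to exhibit one bounded
    fundamental solution. *)
Lemma heat_kernelP :
  fundamental_solution (@heat_kernel R G) /\ bounded_solution (@heat_kernel R G).
Proof.
rewrite /heat_kernel.
apply: (@getPex _ [set H | fundamental_solution H /\ bounded_solution H]).
exists uniformized_kernel; split; last first.
  by move=> v2; exists 1 => v1 t t0; exact/norm_uniformized_kernel_le/ltW.
split=> [v1 v2 t _|v1 v2 t _|v1 v2|v1 v2].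
- exact: (@ex_derive _ _ _ _ _ _ _ (is_derive_uniformized_kernel v1 v2 t)).
- by rewrite derive1E (@derive_val _ _ _ _ _ _ _ (is_derive_uniformized_kernel v1 v2 t)) subrr.
(* The initial condition is continuity at 0, which follows from differentiability there. *)
- rewrite -uniformized_kernel0; apply: cvg_at_right_filter.
  apply: differentiable_continuous; apply/derivable1_diffP.
  exact: (@ex_derive _ _ _ _ _ _ _ (is_derive_uniformized_kernel v1 v2 0)).
- exact: uniformized_kernel0.
Qed.

(** The constant does not depend on [t] because, for fixed [v2], [bounded_solution] bounds the
    kernel over all vertices and positive times at once. *)
Lemma norm_derive1_heat_kernel_le (v1 v2 : V) : exists C, forall t, 0 < t ->
  `|derive1 (heat_kernel v1 v2) t| <= C.
Proof.
have [[_ heatE _ _] bndH] := heat_kernelP.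
have [C HC] := bndH v2; exists ((C + C) * valence v1) => t t0.
have /eqP := heatE v1 v2 t t0; rewrite addrC addr_eq0 => /eqP ->.
by rewrite normrN; apply: norm_laplacian_le => y; exact: HC.
Qed.

End HeatKernel.

(** Valences are nonnegative, so their finite total bounds each of them. *)
Lemma finite_bounded_valence (R : realType) (G : weighted_graph R) :
  finite_set [set: vertex G] -> bounded_valence G.
Proof.
move=> finV; have lf x : finite_set [set y | weight (w:=G) x y != 0].
  exact: sub_finite_set finV.
split=> //; exists (\sum_(x \in [set: vertex G]) valence x) => x.
have valence_ge0 y : 0 <= valence (G := G) y.
  by rewrite valenceE//; apply: sumr_ge0 => z _; exact: weight_ge0.
by rewrite (fsbigD1 x)//= lerDl; exact: fsumr_ge0.
Qed.

Theorem proposition11 (R : realType) (Gt : weighted_graph R)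
    (bddGt : infinite_set [set: vertex Gt] ->
       bounded_valence Gt /\ bounded_degree Gt)
    (G : subgraph Gt) :
  let H := @restricted_heat_kernel R Gt (subvertex G) in
  (forall v1 v2 : subvertex G,
     (v1 = v2 -> H v1 v2 t @[t --> 0^'+] --> (1 : R)) /\
     (v1 <> v2 -> H v1 v2 t @[t --> 0^'+] --> (0 : R))) /\
  (forall v1 v2 : subvertex G,
     exists C : R, forall t : R, 0 < t ->
       derivable (H v1 v2) t 1 /\ `|derive1 (H v1 v2) t| <= C).
Proof.
move=> H.
have [lf [M leM]] : bounded_valence Gt.
  have [finV|/bddGt[]//] := pselect (finite_set [set: vertex Gt]).
  exact: finite_bounded_valence.
(* The given bound may be negative when there are no vertices; the maximum with 0 supplies the sign
   required of the rate. *)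
have M0 : 0 <= Num.max M 0 by rewrite le_max lexx orbT.
have {}leM x : valence (G := Gt) x <= Num.max M 0 by rewrite le_max leM.
have [[dH _ lim0 _] _] := heat_kernelP lf M0 leM.
split=> [v1 v2|v1 v2].
  have := lim0 (val v1) (val v2); rewrite val_eqE => lim12.
  by split=> [|/eqP/negPf] v12; move: lim12; rewrite v12 ?eqxx.
have [C HC] := norm_derive1_heat_kernel_le lf M0 leM (val v1) (val v2).
by exists C => t t0; split; [exact: dH|exact: HC].
Qed.
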